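(* Let $(G,\tau)$ and $(H,\nu)$ be Hausdorff topological groups. The following conditions are equivalent: (i) $(G,\tau)$ and $(H,\nu)$ are $s$-groups; (ii) the direct product $(G,\tau)\times(H,\nu)$ is an $s$-group.
   Context: A set $S$ of sequences in a group $G$ is a $T_s$-set of sequences if there is a Hausdorff group topology on $G$ in which all sequences of $S$ converge to the unit $e_G$; then $\tau_S$ denotes the finest Hausdorff group topology on $G$ with this property. A Hausdorff topological group $(G,\tau)$ is called an $s$-group if $\tau=\tau_S$ for some $T_s$-set $S$ of sequences in $G$. *)

(* Defs.v *)
From HB Require Import structures.
From mathcomp Require Import all_boot all_classical.
From mathcomp Require Import topology.

Set Implicit Arguments.
Unset Strict Implicit.
Unset Printing Implicit Defensive.

Local Open Scope classical_set_scope.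

(* To let several topologies coexist on one group, a topology is represented
   by a class of the [topologicalType] structure on a fixed carrier, and
   [space tau] is that carrier equipped with [tau]. Such a class also packs a
   (mathematically irrelevant) choice structure, so topologies are compared
   through their open sets and not by Leibniz equality of classes. *)
Definition topology_on (X : Type) : Type := Topological.axioms_ X.

Definition space (X : Type) (tau : topology_on X) : topologicalType :=
  Topological.Pack tau.

Definition finer (X : Type) (tau sigma : topology_on X) : Prop :=
  forall U : set X, @open (space sigma) U -> @open (space tau) U.

Definition same_topology (X : Type) (tau sigma : topology_on X) : Prop :=
  @open (space tau) = @open (space sigma) :> set (set X).

Definition direct_product_topology (X Y : Type) (tau : topology_on X) (nu : topology_on Y) :
    topology_on (X * Y) :=
  Topological.class (space tau * space nu)%type.

Definition group_topology (G : groupType) (tau : topology_on G) : Prop :=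
  continuous (fun p : space tau * space tau =>
                ((p.1 : G) * (p.2 : G))%g : space tau) /\
  continuous (fun x : space tau => (x : G)^-1%g : space tau).

Definition hausdorff_group_topology (G : groupType) (tau : topology_on G) : Prop :=
  group_topology tau /\ hausdorff_space (space tau).

Definition converges_to_unit (G : groupType) (tau : topology_on G)
    (S : set (nat -> G)) : Prop :=
  forall u, S u -> (u : nat -> space tau) @ \oo --> (1%g : space tau).

Definition Ts_set (G : groupType) (S : set (nat -> G)) : Prop :=
  exists tau : topology_on G,
    hausdorff_group_topology tau /\ converges_to_unit tau S.

(* [is_tau_S S sigma]: [sigma] is the topology written tau_S. *)
Definition is_tau_S (G : groupType) (S : set (nat -> G))
    (sigma : topology_on G) : Prop :=
  [/\ hausdorff_group_topology sigma,
      converges_to_unit sigma S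
    & forall rho : topology_on G,
        hausdorff_group_topology rho -> converges_to_unit rho S ->
        finer sigma rho].

Definition s_group (G : groupType) (tau : topology_on G) : Prop :=
  hausdorff_group_topology tau /\
  exists S : set (nat -> G),
    Ts_set S /\ exists2 sigma, is_tau_S S sigma & same_topology tau sigma.

(* Main.v *)
Require Import Defs.
From mathcomp Require Import all_boot all_classical.
From mathcomp Require Import topology.

(** A Hausdorff group topology is an s-group topology iff it is the finest one
    making its own null sequences null.  Given this, if [G] and [H] are s-groups
    and [rho] makes all null sequences of the product null, then the topologies
    induced by [rho] on the two factors make the null sequences of the factors
    null; hence both axis embeddings are continuous into [rho], and so is
    (g, h) = (g, 1) (1, h).  Conversely, if [rho] makes the null sequences of [G]
    null, then [rho * nu] makes those of the product null, and the inclusion of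
    [G] as an axis followed by the projection to [rho] is continuous. *)

Set Implicit Arguments.
Unset Strict Implicit.
Unset Printing Implicit Defensive.

Local Open Scope classical_set_scope.

(** Since [hausdorff_space] is phrased with clusters of neighbourhood filters, this gives separation
    both for sources of continuous injections and, through the projections, for products. *)
Lemma cluster_continuous (X Y : topologicalType) (f : X -> Y) (p q : X) :
  continuous f -> cluster (nbhs p) q -> cluster (nbhs (f p)) (f q).
Proof.
move=> fc cpq A B /(fc p) Ap /(fc q) Bq.
by have [x [Ax Bx]] := cpq _ _ Ap Bq; exists (f x).
Qed.

Lemma hausdorff_continuous_inj (X Y : topologicalType) (f : X -> Y) :
  continuous f -> injective f -> hausdorff_space Y -> hausdorff_space X.
Proof. by move=> fc fI hY p q /(cluster_continuous fc)/hY/fI. Qed.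

Lemma continuous_pair (X Y Z : topologicalType) (f : X -> Y) (g : X -> Z) :
  continuous f -> continuous g -> continuous (fun x => (f x, g x)).
Proof. by move=> fc gc x; apply: cvg_pair; [exact: fc|exact: gc]. Qed.

Lemma continuous_compT (X Y Z : topologicalType) (f : X -> Y) (g : Y -> Z) :
  continuous f -> continuous g -> continuous (g \o f).
Proof. by move=> fc gc x; apply: continuous_comp; [exact: fc|exact: gc]. Qed.

Lemma continuous_fst (X Y : topologicalType) : continuous (@fst X Y).
Proof. by move=> x; exact: cvg_fst. Qed.

Lemma continuous_snd (X Y : topologicalType) : continuous (@snd X Y).
Proof. by move=> x; exact: cvg_snd. Qed.

Lemma hausdorff_prod (X Y : topologicalType) :
  hausdorff_space X -> hausdorff_space Y -> hausdorff_space (X * Y)%type.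
Proof.
move=> hX hY [a b] [c d] cl.
have /hX /= -> := cluster_continuous (@continuous_fst X Y) cl.
by have /hY /= -> := cluster_continuous (@continuous_snd X Y) cl.
Qed.

Lemma finerP (X : Type) (tau sigma : topology_on X) :
  finer tau sigma <-> continuous (fun x : space tau => x : space sigma).
Proof. by split=> [f|/continuousP f]; [apply/continuousP|]. Qed.

Definition null_seqs (G : groupType) (tau : topology_on G) : set (nat -> G) :=
  [set u | (u : nat -> space tau) @ \oo --> (1%g : space tau)].

(** If [tau] is the finest topology for [S], then [S] consists of null sequences of [tau], so a
    [rho] making the latter null competes for [S] too. Conversely, [null_seqs tau] itself serves as
    [S]. *)
Lemma s_groupP (G : groupType) (tau : topology_on G) :
  hausdorff_group_topology tau ->
  s_group tau <->
  (forall rho : topology_on G, hausdorff_group_topology rho ->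
     converges_to_unit rho (null_seqs tau) -> finer tau rho).
Proof.
move=> tauP; split=> [[_ [S [_ [sigma [_ sS smin] ts]]]] rho rhoP rhoS|tmin].
  rewrite /same_topology in ts.
  rewrite /finer ts; apply: smin => // u Su; apply: rhoS.
  (* [tau] and [sigma] are only known to share their open sets, so convergence passes from one to
     the other along the continuous identity map. *)
  have st : finer sigma tau by rewrite /finer ts.
  move/finerP/(_ 1%g): st => st.
  exact: cvg_comp (sS _ Su) st.
split=> //; exists (null_seqs tau).
have tN : converges_to_unit tau (null_seqs tau) by move=> u.
by split; exists tau.
Qed.

Lemma morph_mulg1 (G K : groupType) (f : G -> K) :
  {morph f : x y / (x * y)%g} -> f 1%g = 1%g.
Proof. by move=> fM; apply: (mulgI (f 1%g)); rewrite -fM !mulg1. Qed.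

(* [tau] only supplies the choice structure on [X]. *)
Definition induced_topology (X Y : Type) (tau : topology_on X) (rho : topology_on Y)
    (f : X -> Y) : topology_on X :=
  Topological.class (initial_topology (f : space tau -> space rho)).

Lemma continuous_induced (X Y : Type) (tau : topology_on X) (rho : topology_on Y)
    (f : X -> Y) :
  continuous (f : space (induced_topology tau rho f) -> space rho).
Proof. exact: (@initial_continuous (space tau) (space rho) f). Qed.

(** A map into the initial topology is continuous once its composite with [f] is; as [f] is a
    morphism, that composite is the operation of [K] applied after [f]. Injectivity pulls back
    separation. *)
Lemma induced_hausdorff_group_topology (G K : groupType) (tau : topology_on G)
    (rho : topology_on K) (f : G -> K) :
  injective f -> {morph f : x y / (x * y)%g} ->
  hausdorff_group_topology rho ->
  hausdorff_group_topology (induced_topology tau rho f).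
Proof.
move=> fI fM [[mc ic] hrho].
have fc := @continuous_induced _ _ tau rho f.
have fV x : f x^-1%g = (f x)^-1%g.
  by apply: (mulgI (f x)); rewrite -fM !mulgV (morph_mulg1 fM).
split; last exact: hausdorff_continuous_inj fc fI hrho.
split.
- apply: (@continuous_comp_initial (space tau) _ (space rho) f).
  have -> : f \o (fun p : G * G => (p.1 * p.2)%g) =
     (fun p : K * K => (p.1 * p.2)%g) \o (fun p : G * G => (f p.1, f p.2)).
    by apply/funext => p /=; rewrite fM.
  apply: (continuous_compT _ mc).
  by apply: continuous_pair; apply: continuous_compT fc;
    [exact: continuous_fst|exact: continuous_snd].
- apply: (@continuous_comp_initial (space tau) _ (space rho) f).
  have -> : f \o (fun x : G => x^-1%g) = (fun x : K => x^-1%g) \o f.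
    by apply/funext => p /=; rewrite fV.
  exact: continuous_compT fc ic.
Qed.

(** A neighbourhood of 1 contains the preimage of some open [W] of [rho], and [W] contains
    [f 1 = 1]. *)
Lemma induced_null (G K : groupType) (tau : topology_on G) (rho : topology_on K)
    (f : G -> K) (u : nat -> G) :
  f 1%g = 1%g -> null_seqs rho (f \o u) ->
  null_seqs (induced_topology tau rho f) u.
Proof.
move=> f1 fu A [_ [[W oW <-]] W1 /filterS]; apply.
by apply: fu; apply: open_nbhs_nbhs; rewrite -f1.
Qed.

(** The topology induced by [rho] along [f] makes every null sequence of [tau] null, so [tau] is
    finer than it. *)
Lemma s_group_continuous_morphism (G K : groupType) (tau : topology_on G)
    (rho : topology_on K) (f : G -> K) :
  s_group tau -> hausdorff_group_topology rho ->
  injective f -> {morph f : x y / (x * y)%g} ->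
  (forall u, null_seqs tau u -> null_seqs rho (f \o u)) ->
  continuous (f : space tau -> space rho).
Proof.
move=> sG rhoP fI fM fnull.
have /(s_groupP sG.1) tmin := sG.
have /finerP tc : finer tau (induced_topology tau rho f).
  apply: tmin.
    exact: induced_hausdorff_group_topology.
  by move=> u /fnull; apply: induced_null; exact: morph_mulg1.
exact: continuous_compT tc (@continuous_induced _ _ tau rho f).
Qed.

Lemma direct_product_hausdorff_group_topology (G H : groupType)
    (tau : topology_on G) (nu : topology_on H) :
  hausdorff_group_topology tau -> hausdorff_group_topology nu ->
  @hausdorff_group_topology (G * H)%type (direct_product_topology tau nu).
Proof.
move=> [[mt it] ht] [[mn inn] hn]; split; last exact: hausdorff_prod ht hn.
have c1 := @continuous_fst (space tau) (space nu).
have c2 := @continuous_snd (space tau) (space nu).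
pose P := (space tau * space nu)%type.
have d1 := @continuous_fst P P.
have d2 := @continuous_snd P P.
split; apply: (@continuous_pair _ (space tau) (space nu)).
- exact: (continuous_compT (continuous_pair (continuous_compT d1 c1)
                                            (continuous_compT d2 c1)) mt).
- exact: (continuous_compT (continuous_pair (continuous_compT d1 c2)
                                            (continuous_compT d2 c2)) mn).
- exact: continuous_compT c1 it.
- exact: continuous_compT c2 inn.
Qed.

Lemma direct_product_null (G H : groupType) (tau : topology_on G)
    (nu : topology_on H) (u : nat -> G * H) :
  @null_seqs (G * H)%type (direct_product_topology tau nu) u <->
  null_seqs tau (fst \o u) /\ null_seqs nu (snd \o u).
Proof.
split=> [un|[u1 u2]].
  pose one := (1%g, 1%g) : space tau * space nu.
  split=> A.
    by move=> /(@continuous_fst (space tau) (space nu) one)/un.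
  by move=> /(@continuous_snd (space tau) (space nu) one)/un.
have -> : u = (fun n => ((fst \o u) n, (snd \o u) n)).
  by apply/funext => n /=; case: (u n).
exact: (cvg_pair u1 u2).
Qed.

Lemma null_seqs_cst1 (G : groupType) (tau : topology_on G) :
  null_seqs tau (fun=> 1%g).
Proof. exact: (@cvg_cst (space tau)). Qed.

Theorem theorem1p13 (G H : groupType) (tau : topology_on G) (nu : topology_on H)
  (tauP : hausdorff_group_topology tau) (nuP : hausdorff_group_topology nu) :
  (s_group tau /\ s_group nu) <->
  @s_group (G * H)%type (direct_product_topology tau nu).
Proof.
have prodP := direct_product_hausdorff_group_topology tauP nuP.
split=> [[sG sH]|/(s_groupP prodP) pmin].
  apply/(s_groupP prodP) => rho rhoP rhoN; apply/finerP.
  pose i1 (g : G) : G * H := (g, 1%g); pose i2 (h : H) : G * H := (1%g, h).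
  have c1 : continuous (i1 : space tau -> space rho).
    apply: s_group_continuous_morphism => //; first by move=> x y [].
      by move=> x y; congr (_, _); rewrite mulg1.
    (* On the axis the second coordinate is constantly 1, so the sequence is null in the product,
       hence in [rho]. *)
    move=> u un; apply: rhoN; apply/direct_product_null; split => //.
    exact: null_seqs_cst1.
  have c2 : continuous (i2 : space nu -> space rho).
    apply: s_group_continuous_morphism => //; first by move=> x y [].
      by move=> x y; congr (_, _); rewrite mulg1.
    move=> u un; apply: rhoN; apply/direct_product_null; split => //.
    exact: null_seqs_cst1.
  have -> : (fun x : G * H => x) =
      (fun p : (G * H) * (G * H) => (p.1 * p.2)%g) \o
      (fun x : G * H => (i1 x.1, i2 x.2)).
    by apply/funext => -[g h] /=; congr (_, _); rewrite /= ?mulg1 ?mul1g.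
  apply: (continuous_compT _ rhoP.1.1).
  apply: continuous_pair.
    exact: continuous_compT (@continuous_fst (space tau) (space nu)) c1.
  exact: continuous_compT (@continuous_snd (space tau) (space nu)) c2.
split; apply/s_groupP => // rho rhoP rhoN; apply/finerP.
- have /finerP c : @finer (G * H)%type (direct_product_topology tau nu)
      (direct_product_topology rho nu).
    apply: pmin; first exact: direct_product_hausdorff_group_topology.
    move=> u /direct_product_null[u1 u2].
    by apply/direct_product_null; split=> //; exact: rhoN.
  (* Following this embedding by [c] and the first projection gives the identity from [tau] to
     [rho]. *)
  have i1 : continuous (fun g : space tau => (g, (1%g : H) : space nu)).
    by apply: continuous_pair => x; [exact: cvg_id|exact: cvg_cst].
  exact: continuous_compT (continuous_compT i1 c)
    (@continuous_fst (space rho) (space nu)).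
- have /finerP c : @finer (G * H)%type (direct_product_topology tau nu)
      (direct_product_topology tau rho).
    apply: pmin; first exact: direct_product_hausdorff_group_topology.
    move=> u /direct_product_null[u1 u2].
    by apply/direct_product_null; split=> //; exact: rhoN.
  have i2 : continuous (fun h : space nu => ((1%g : G) : space tau, h)).
    by apply: continuous_pair => x; [exact: cvg_cst|exact: cvg_id].
  exact: continuous_compT (continuous_compT i2 c)
    (@continuous_snd (space tau) (space rho)).
Qed.
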